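(* Let $A$ be a unital commutative $\mathbb{R}$-algebra, let $M$ be a quadratic module of $A$, and let $\emptyset\neq X\subseteq\mathcal{X}(A)$. Then the closure of $M$ with respect to the topology $\mathcal{T}_X$ is $$\overline{M}^{\mathcal{T}_X}=\mathrm{Psd}(X\cap\mathcal{K}_M).$$
   Context: A quadratic module of $A$ is a set $M\subseteq A$ containing $0$ and $1$ with $M+M\subseteq M$, $\mathbb{R}_{\ge0}\cdot M\subseteq M$ and $\sum A^2\cdot M\subseteq M$. $\mathcal{X}(A)$ is the set of all real valued $\mathbb{R}$-algebra homomorphisms on $A$, with the subspace topology inherited from the product topology on $\mathbb{R}^A$. $\mathcal{K}_M:=\{\alpha\in\mathcal{X}(A) : \alpha(M)\subseteq\mathbb{R}_{\ge0}\}$. For $K\subseteq\mathcal{X}(A)$, $\mathrm{Psd}(K):=\{a\in A : \alpha(a)\ge0 \text{ for all } \alpha\in K\}$ (so $\mathrm{Psd}(\emptyset)=A$). For a non-empty compact $D\subseteq\mathcal{X}(A)$, $\rho_D(a):=\sup_{\alpha\in D}|\alpha(a)|$ is a submultiplicative seminorm on $A$. For non-empty $X\subseteq\mathcal{X}(A)$, $\mathcal{T}_X$ is the locally convex topology on $A$ induced by the family of seminorms $\{\rho_D : \emptyset\ne D\subseteq X,\ D \text{ compact}\}$. *)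

(* Defs.v *)
From HB Require Import structures.
From mathcomp Require Import all_boot all_order all_algebra.
From mathcomp Require Import all_classical all_reals all_analysis.

Set Implicit Arguments.
Unset Strict Implicit.
Unset Printing Implicit Defensive.

Import Order.TTheory GRing.Theory Num.Theory numFieldNormedType.Exports.

Local Open Scope classical_set_scope.
Local Open Scope ring_scope.

(* comAlgType excludes the zero algebra, which has no character. *)
Definition character (R : realType) (A : comAlgType R) : Type :=
  {lrmorphism A -> R | *%R}.

Definition char_eval (R : realType) (A : comAlgType R) (alpha : character A) :
  {ptws A -> R} := (alpha : {lrmorphism A -> R | *%R}).

HB.instance Definition _ (R : realType) (A : comAlgType R) :=
  gen_eqMixin (character A).
HB.instance Definition _ (R : realType) (A : comAlgType R) :=
  gen_choiceMixin (character A).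
(* the subspace topology inherited from the product topology on A -> R *)
HB.instance Definition _ (R : realType) (A : comAlgType R) :=
  Topological.copy (character A) (initial_topology (@char_eval R A)).

Section QuadraticModules.
Variables (R : realType) (A : comAlgType R).
Implicit Types (M : set A) (K D X : set (character A)).

Definition sums_of_squares : set A :=
  [set s | exists r : seq A, s = \sum_(x <- r) x ^+ 2].

Record quadratic_module M : Prop := QuadraticModule {
  quadratic_module0 : M 0;
  quadratic_module1 : M 1;
  quadratic_moduleD : forall x y, M x -> M y -> M (x + y);
  quadratic_moduleZ : forall (c : R) x, 0 <= c -> M x -> M (c *: x);
  quadratic_moduleM : forall s x, sums_of_squares s -> M x -> M (s * x)
}.

Definition nonneg_characters M : set (character A) :=
  [set alpha | forall a, M a -> 0 <= char_eval alpha a].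

Definition Psd K : set A :=
  [set a | forall alpha, K alpha -> 0 <= char_eval alpha a].

(* Only used for D non-empty and compact, where the supremum exists; elsewhere
   sup may return the default value 0. *)
Definition rho D (a : A) : R := sup [set `|char_eval alpha a| | alpha in D].

Definition rho_family X : set (A -> R) :=
  [set rho D | D in [set D | [/\ D !=set0, compact D & D `<=` X]]].

End QuadraticModules.

(* V with the topology induced by the family of seminorms P: the open balls
   [set y | p (y - x) < e], for p in P, x in V and e > 0, form a subbase.
   When the members of P are seminorms, the finite intersections of such balls
   centred at a form a neighbourhood base at a. *)
Definition seminorm_topology (R : realType) (V : zmodType)
  (P : set (V -> R)) : Type := V.

Section SeminormTopology.
Variables (R : realType) (V : zmodType) (P : set (V -> R)).

HB.instance Definition _ := Choice.copy (seminorm_topology P) V.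

HB.instance Definition _ :=
  @isSubBaseTopological.Build (seminorm_topology P) ((V -> R) * V * R)%type
    [set i | P i.1.1 /\ 0 < i.2]
    (fun i => [set y : V | i.1.1 (y - i.1.2) < i.2]).

End SeminormTopology.

(* Main.v *)
(* The closure lies in the positivity set because a single character is a
   compact set.  Conversely let [a] be nonnegative on the [M]-nonnegative
   characters of a compact set [D].  Stone-Weierstrass is replaced by the
   iteration [s + (c - s ^+ 2) / 2], carried out inside [A], which converges to
   [sqrt c] uniformly on the characters with [0 <= c <= 1]; it makes squares of
   elements of [A] approximate positive parts uniformly on [D].  Where [a < 0],
   some [m] in [M] is negative, and multiplying it by a square close to its
   negative part gives an element of [M] that is locally very negative and
   almost nonpositive on all of [D].  Adding finitely many of these yields [g]
   in [M] with [a - g + e >= 0] on [D]; then [a - g + e] is nearly a square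
   [b ^+ 2] and [b ^+ 2 + g] in [M] approximates [a]. *)
Require Import Defs.
From mathcomp Require Import all_boot all_order all_algebra.
From mathcomp Require Import all_classical all_reals all_analysis.
From mathcomp Require Import ring lra.

Set Implicit Arguments.
Unset Strict Implicit.
Unset Printing Implicit Defensive.

Import Order.TTheory GRing.Theory Num.Theory numFieldNormedType.Exports.

Local Open Scope classical_set_scope.
Local Open Scope ring_scope.

(** * Square roots and positive parts up to a uniform error *)

Section Approximation.
Variables (R : realType) (A : comAlgType R).
Implicit Types (alpha : character A) (c : A) (C e : R).

Lemma char_evalE alpha :
  ((char_eval alpha 0 = 0)%R * (char_eval alpha 1 = 1)%R *
  ((forall x y : A, char_eval alpha (x + y) = char_eval alpha x + char_eval alpha y)%R *
   (forall x : A, char_eval alpha (- x) = - char_eval alpha x)%R *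
   (forall x y : A, char_eval alpha (x * y) = char_eval alpha x * char_eval alpha y)%R *
   (forall (x : A) n, char_eval alpha (x ^+ n) = char_eval alpha x ^+ n)%R *
   (forall k (x : A), char_eval alpha (k *: x) = k * char_eval alpha x)%R))%type.
Proof.
rewrite /char_eval; do !split; move=> *;
by rewrite ?(rmorph0, rmorph1, rmorphD, rmorphN, rmorphM, rmorphXn, linearZ).
Qed.

Fixpoint sqrt_iter n c : A :=
  if n is m.+1 then
    sqrt_iter m c + 2^-1 *: (c - sqrt_iter m c ^+ 2)
  else 0.

(* With [e = r - s], the error of the next step is [e * (1 - (r + s) / 2)], so
   that [e * (2 + N * r) <= 2 * r], a bound on [N * e] uniform in [r], is
   preserved. *)
Lemma sqrt_step (r s N : R) (s' := s + 2^-1 * (r ^+ 2 - s ^+ 2)) :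
  r <= 1 -> 0 <= N -> 0 <= s -> s <= r -> (r - s) * (2 + N * r) <= 2 * r ->
  [/\ 0 <= s', s' <= r & (r - s') * (2 + (N + 1) * r) <= 2 * r].
Proof.
move=> r1 N0 s0 sr IH; have r0 := le_trans s0 sr.
have rs0 : 0 <= r - s by rewrite subr_ge0.
have rs2 : 0 <= 2 - (r + s) by lra.
have H1 := mulr_ge0 rs0 rs2.
have H2 := mulr_ge0 rs0 (addr_ge0 r0 s0).
rewrite {}/s'; split; [nra|nra|].
have -> : r - (s + 2^-1 * (r ^+ 2 - s ^+ 2)) = (r - s) * (1 - (r + s) / 2).
  by field.
apply: le_trans IH; rewrite -mulrA ler_wpM2l//.
have NR : 0 <= (N + 1) * r by rewrite mulr_ge0// addr_ge0.
have := mulr_ge0 NR r0; have := mulr_ge0 NR s0; nra.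
Qed.

Lemma sqrt_iter_bounds alpha c n (r := Num.sqrt (char_eval alpha c))
    (s := char_eval alpha (sqrt_iter n c)) :
  0 <= char_eval alpha c <= 1 ->
  [/\ 0 <= s, s <= r & (r - s) * (2 + n%:R * r) <= 2 * r].
Proof.
move=> /andP[c0 c1]; have r0 : 0 <= r by exact: sqrtr_ge0.
have r1 : r <= 1 by rewrite -sqrtr1 ler_wsqrtr.
rewrite {}/s; elim: n => [|n [s0 sr IH]].
  by split; rewrite ?char_evalE// subr0 mul0r addr0 mulrC.
rewrite -[sqrt_iter n.+1 c]/(sqrt_iter n c + 2^-1 *: (c - sqrt_iter n c ^+ 2)).
rewrite !char_evalE -(sqr_sqrtr c0) -/r -[n.+1%:R]natr1.
exact: sqrt_step.
Qed.

(** Dividing by [C] brings [c] into the range of the iteration. Multiplying back by [q], where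
    [q ^+ 2 = C], turns the error [2 / n] into [2 * q / n], which is below [e] for large [n]. *)
Lemma sqrt_approx c C e : 0 < C -> 0 < e -> exists b : A, forall alpha,
  0 <= char_eval alpha c <= C ->
  [/\ 0 <= char_eval alpha b, char_eval alpha b <= Num.sqrt (char_eval alpha c)
    & Num.sqrt (char_eval alpha c) <= char_eval alpha b + e].
Proof.
move=> C0 e0; set q := Num.sqrt C; have q0 : 0 < q by rewrite sqrtr_gt0.
have [n ne] : exists n : nat, 2 * q / e < n%:R.
  exists (Num.bound (2 * q / e)); apply: archi_boundP.
  by rewrite divr_ge0 ?mulr_ge0// ltW.
have n0 : 0 < n%:R :> R.
  by apply: le_lt_trans ne; rewrite divr_ge0 ?mulr_ge0// ltW.
exists (q *: sqrt_iter n (C^-1 *: c)) => alpha /andP[c0 cC].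
have [] := @sqrt_iter_bounds alpha (C^-1 *: c) n.
  by rewrite char_evalE ler_pdivrMl// mulr1 cC mulr_ge0// invr_ge0 ltW.
have V0 : 0 <= C^-1 by rewrite invr_ge0 ltW.
rewrite !char_evalE (sqrtrM _ V0) (sqrtrV (ltW C0)) -/q.
set s := char_eval _ _; set t := Num.sqrt _ => s0 st H.
have t0 : 0 <= t by exact: sqrtr_ge0.
have tE : t = q * (q^-1 * t) by rewrite mulrA divff ?mul1r// gt_eqF.
set r := q^-1 * t in st H tE.
have r0 : 0 <= r by rewrite mulr_ge0// invr_ge0 ltW.
rewrite tE; split; [by rewrite mulr_ge0// ltW|by rewrite ler_wpM2l// ltW|].
have ns : n%:R * (r - s) <= 2.
  have [->|rn0] := eqVneq r 0.
    by apply: le_trans (_ : 0 <= _) => //; rewrite mulr_ge0_le0 ?ler0n//; lra.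
  have rp : 0 < r by rewrite lt_neqAle eq_sym rn0.
  rewrite -(ler_pM2r rp); nra.
have := ltW ne; rewrite ler_pdivrMr// => ne'.
rewrite -(ler_pM2l n0); nra.
Qed.

Lemma square_approx c C e : 0 < C -> 0 < e -> exists b : A, forall alpha,
  0 <= char_eval alpha c <= C ->
  char_eval alpha c - e <= char_eval alpha b ^+ 2 <= char_eval alpha c.
Proof.
move=> C0 e0; set q := Num.sqrt C; have q0 : 0 < q by rewrite sqrtr_gt0.
(* The squares of the root [r] and of its approximation [s] differ by [(r - s) * (r + s)], and
   [r + s <= 2 * q]. *)
have [|b Hb] := @sqrt_approx c C (e / (2 * q)) C0.
  by rewrite divr_gt0// mulr_gt0.
exists b => alpha cC; have [] := Hb alpha cC.
case/andP: cC => c0 cC; have := ler_wsqrtr cC; rewrite -/q.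
rewrite -{4 5}(sqr_sqrtr c0).
set s := char_eval _ b; set r := Num.sqrt _ => rq s0 sr.
rewrite -lerBlDl ler_pdivlMr ?mulr_gt0// => H; nra.
Qed.

(** The positive part is half of [c + |c|], and [|c|] is the square root of [c ^+ 2]. As [b1]
    approximates [|c|] from below, adding [e] keeps nonnegative the element that is then
    approximated by a square. *)
Lemma pos_part_approx c C e : 0 < C -> 0 < e -> exists b : A, forall alpha,
  `|char_eval alpha c| <= C ->
  `|char_eval alpha b ^+ 2 - Num.max (char_eval alpha c) 0| <= e.
Proof.
move=> C0 e0.
have [b1 Hb1] := @sqrt_approx (c ^+ 2) (C ^+ 2) e (exprn_gt0 _ C0) e0.
have Ce : 0 < C + e by rewrite addr_gt0.
have [b2 Hb2] := @square_approx (2^-1 *: (c + b1 + e *: 1)) _ e Ce e0.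
exists b2 => alpha cC.
have /Hb1 : 0 <= char_eval alpha (c ^+ 2) <= C ^+ 2.
  by rewrite char_evalE sqr_ge0 -real_normK ?num_real// lerXn2r// nnegrE// ltW.
move: (Hb2 alpha); rewrite !char_evalE sqrtr_sqr mulr1.
set x := char_eval alpha c in cC *; set s := char_eval alpha b1.
set y := _ ^+ 2 => H [s0 sx xs].
move: H cC sx xs; rewrite ler_distl.
have [x0|x0] := leP 0 x.
  rewrite ger0_norm// => H xC sx xs; lra.
rewrite ltr0_norm// => H xC sx xs; lra.
Qed.

End Approximation.

(** Otherwise the sets whose complement in [K] lies in [I] form a proper filter containing [K], and
    a cluster point of it in [K] has no neighbourhood in [I]. *)
Lemma compact_ideal (T : topologicalType) (K : set T) (I : set (set T)) :
  compact K -> I set0 -> (forall U V, U `<=` V -> I V -> I U) ->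
  (forall U V, I U -> I V -> I (U `|` V)) ->
  (forall x, K x -> exists2 U, nbhs x U & I U) -> I K.
Proof.
move=> cK I0 Isub IU Iloc; apply: contrapT => nIK.
pose F : set_system T := [set V | I (K `\` V)].
have FF : ProperFilter F.
  split; first by rewrite /F /= setD0.
  split; rewrite /F /= ?setDT//.
  - by move=> P Q FP FQ; rewrite /F /= setDIr; exact: IU.
  - by move=> P Q PQ; apply: Isub; exact: setDS.
have [|x [Kx clx]] := cK F FF; first by rewrite /F /= setDv.
have [U Ux IUU] := Iloc x Kx.
have [|y [nUy Uy]] // := clx (~` U) U _ Ux.
by rewrite /F /= setDE setCK; apply: Isub IUU; exact: subIsetr.
Qed.

(** * Compact sets of characters and approximation from a quadratic module *)

Section Characters.
Variables (R : realType) (A : comAlgType R).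
Implicit Types (M : set A) (D X : set (character A)) (a : A).

Lemma char_eval_continuous a :
  continuous (fun alpha : character A => char_eval alpha a).
Proof.
move=> alpha; apply: (@continuous_comp _ {ptws A -> R} _
  (@char_eval R A) (fun f : {ptws A -> R} => f a)).
  exact: initial_continuous.
exact: (@proj_continuous A (fun=> R) a).
Qed.

Lemma compact_char_bounded D a : compact D ->
  exists2 C : R, 0 < C & forall alpha, D alpha -> `|char_eval alpha a| <= C.
Proof.
move=> cD.
have : compact [set char_eval alpha a | alpha in D].
  apply: (@continuous_compact _ _ (fun alpha => char_eval alpha a)) => //.
  by apply: continuous_subspaceT; exact: char_eval_continuous.
move=> /compact_bounded[C [_ HC]]; exists (`|C| + 1); first by rewrite ltr_wpDl.
move=> alpha Da; apply: (HC (`|C| + 1)); last by exists alpha.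
by rewrite (le_lt_trans (ler_norm C))// ltrDl.
Qed.

Lemma quadratic_module_sqrM M b m :
  quadratic_module M -> M m -> M (b ^+ 2 * m).
Proof.
by move=> QM Mm; apply: quadratic_moduleM => //; exists [:: b]; rewrite big_seq1.
Qed.

(* [g = b ^+ 2 * m] with [b ^+ 2] within 1 of the negative part of [m]; where
   [m <= - (2 * T)] this gives [g <= - (2 * T - 1) * (2 * T)], hence [1 <= T]. *)
Lemma quadratic_module_clamp M D m (T e : R) :
  quadratic_module M -> compact D -> M m -> 1 <= T -> 0 < e ->
  exists2 g, M g & forall alpha, D alpha ->
    char_eval alpha g <= e /\
    (char_eval alpha m <= - (2 * T) -> char_eval alpha g <= - T).
Proof.
move=> QM cD Mm T1 e0; have [C C0 HC] := compact_char_bounded m cD.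
(* The bound [e / C] is for the characters with [m > 0]: there [b ^+ 2 <= e / C] and [m <= C], so
   [g <= e]. *)
have d0 : 0 < Num.min 1 (e / C) by rewrite lt_min ltr01 divr_gt0.
have [b Hb] := pos_part_approx (- m) C0 d0.
exists (b ^+ 2 * m); first exact: quadratic_module_sqrM.
move=> alpha Da; have mC := HC alpha Da; have := Hb alpha.
rewrite !char_evalE normrN => /(_ mC).
set x := char_eval alpha m in mC *; set y := char_eval alpha b ^+ 2.
have y0 : 0 <= y by exact: sqr_ge0.
rewrite le_min => /andP[].
have [x0|x0] := leP 0 (- x).
  by rewrite ler_distl => /andP[H _] _; split => [|xT]; nra.
rewrite subr0 (ger0_norm y0) ler_pdivlMr// => _ H; split => [|xT]; last by lra.
apply: le_trans H; rewrite ler_wpM2l//; exact: le_trans (ler_norm x) mC.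
Qed.

Lemma Psd_approx M D a (e : R) :
  quadratic_module M -> compact D ->
  D `&` nonneg_characters M `<=` [set alpha | 0 <= char_eval alpha a] ->
  0 < e ->
  exists2 y, M y & forall alpha, D alpha -> `|char_eval alpha (y - a)| <= e.
Proof.
move=> QM cD Na e0; have [C C0 HC] := compact_char_bounded a cD.
(* As [a >= - C] on [D], lowering [g] to [d - T] gives [a - g >= 1 - d]. *)
pose T := C + 1; have T1 : 1 <= T by rewrite lerDr ltW.
(* Quantifying over [d] makes [cut] stable under unions: elements for [d / 2] add up to one for
   [d]. *)
pose cut (U : set (character A)) := forall d : R, 0 < d -> exists2 g, M g &
  forall alpha, D alpha -> char_eval alpha g <= d /\
  (U alpha -> char_eval alpha a <= - (e / 2) -> char_eval alpha g <= d - T).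
have cutD : cut D.
  apply: (compact_ideal cD).
  - move=> d d0; exists 0; first exact: quadratic_module0.
    by move=> alpha _; rewrite char_evalE ltW.
  - move=> U V UV cV d /cV[g Mg Hg]; exists g => // alpha /Hg[gd gT].
    by split=> // /UV.
  - move=> U V cU cV d d0; have d20 : 0 < d / 2 by lra.
    have [g Mg Hg] := cU _ d20; have [h Mh Hh] := cV _ d20.
    exists (g + h); first exact: quadratic_moduleD.
    move=> alpha Da; have [g1 g2] := Hg _ Da; have [h1 h2] := Hh _ Da.
    rewrite char_evalE; split; first by lra.
    by case=> [/g2|/h2] H /H; lra.
  - move=> beta Db.
    have [ae|ea] := leP (char_eval beta a) (- (e / 2)); last first.
      exists [set alpha | - (e / 2) < char_eval alpha a].
        exact: (char_eval_continuous (lt_nbhsr ea)).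
      move=> d d0; exists 0; first exact: quadratic_module0.
      move=> alpha _; rewrite char_evalE ltW//; split => //= H1 H2; lra.
    have : ~ nonneg_characters M beta.
      by move=> Nb; have /= := Na beta (conj Db Nb); lra.
    move=> /existsNP[m /not_implyP[Mm /negP]]; rewrite -ltNge => bm.
    (* This gives [k *: m] the value [- (2 * T + 1)] at [beta], so it stays below the threshold
       [- (2 * T)] nearby. *)
    pose k := (- (2 * T + 1)) / char_eval beta m.
    have k0 : 0 <= k by rewrite ltW// nmulr_rgt0 ?invr_lt0//; lra.
    exists [set alpha | char_eval alpha (k *: m) < - (2 * T)].
      apply: (char_eval_continuous (lt_nbhsl _)).
      by rewrite char_evalE /k divfK ?lt_eqF//; lra.
    move=> d d0.
    have [g Mg Hg] := quadratic_module_clamp QM cD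
      (quadratic_moduleZ QM k0 Mm) T1 d0.
    exists g => // alpha /Hg[g1 g2]; split=> // /ltW/g2 H _; lra.
(* Where [a > - (e / 2)], the bound [g <= e / 3] still leaves [a - g + e > 0]. *)
have [g Mg Hg] := cutD (e / 3) ltac:(lra).
have [Cg Cg0 HCg] := compact_char_bounded g cD.
pose c := a - g + e *: 1.
have K0 : 0 < C + Cg + e by lra.
have [b Hb] := square_approx c K0 e0.
(* On [D] the square lies between [a - g] and [a - g + e]. *)
exists (b ^+ 2 * 1 + g).
  apply: quadratic_moduleD => //; apply: quadratic_module_sqrM => //.
  exact: quadratic_module1.
move=> alpha Da; have [g1 g2] := Hg _ Da.
have := HC _ Da; have := HCg _ Da; rewrite !ler_norml => /andP[? ?] /andP[? ?].
have := Hb alpha; rewrite /c !char_evalE !mulr1.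
set x := char_eval alpha a in g2 *; set z := char_eval alpha g in g1 g2 *.
have x0 : 0 <= x - z + e.
  by have [/(g2 Da)|] := leP x (- (e / 2)); rewrite /T; lra.
have xK : x - z + e <= C + Cg + e by lra.
by rewrite x0 xK => /(_ isT)/andP[? ?]; apply/andP; split; lra.
Qed.

(** * Neighbourhoods in the seminorm topology *)

Lemma rho_ge D a alpha :
  compact D -> D alpha -> `|char_eval alpha a| <= rho D a.
Proof.
move=> cD Da; have [C _ HC] := compact_char_bounded a cD.
apply: ub_le_sup; last by exists alpha.
by exists C => _ [beta Db <-]; exact: HC.
Qed.

Lemma rho_le D a (e : R) :
  D !=set0 -> (forall alpha, D alpha -> `|char_eval alpha a| <= e) ->
  rho D a <= e.
Proof.
move=> [alpha Da] H; apply: ge_sup; first by exists `|char_eval alpha a|, alpha.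
by move=> _ [beta Db <-]; exact: H.
Qed.

Lemma nbhs_rho_ball X D a x (e : R) :
  rho_family X (rho D) -> 0 < e -> rho D (a - x) < e ->
  @nbhs _ (seminorm_topology (rho_family X)) a [set y | rho D (y - x) < e].
Proof.
move=> XD e0 ae; rewrite nbhsE.
exists [set y | rho D (y - x) < e] => //; split => //.
pose B := [set [set y | rho D (y - x) < e]].
exists B; last by rewrite /B bigcup_set1.
move=> _ ->; apply: (@finI_from1 _ _ _ _ (rho D, x, e)); by split.
Qed.

(** Finitely many compact sets are merged into their union. The bound is pointwise because [D] is
    empty when no seminorm is involved. *)
Lemma nbhs_rho_family X a B :
  @nbhs _ (seminorm_topology (rho_family X)) a B ->
  exists D (e : R), [/\ compact D, D `<=` X, 0 < e &
    forall y, (forall alpha, D alpha -> `|char_eval alpha (y - a)| <= e) -> B y].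
Proof.
rewrite nbhsE => -[_ [[G GB <-] [U GU Ua]] UB].
have [J Jp UE] := GB U GU.
pose s : seq ((A -> R) * A * R) := finmap.enum_fset J.
suff [D [e [cD DX e0 HD]]] : exists D (e : R), [/\ compact D, D `<=` X, 0 < e &
    forall y, (forall alpha, D alpha -> `|char_eval alpha (y - a)| <= e) ->
    forall i, i \in s -> i.1.1 (y - i.1.2) < i.2].
  exists D, e; split => // y /HD Hy; apply: UB; exists U => //.
  by change ((U : set A) y); rewrite -UE => i /Hy.
have : forall i, i \in s ->
    [/\ rho_family X i.1.1, 0 < i.2 & i.1.1 (a - i.1.2) < i.2].
  move=> i iJ; have /set_mem[Xi i0] := Jp i iJ.
  by split => //; move: (Ua : (U : set A) a); rewrite -UE; exact.
elim: s => [|[[p x] r] s IH] Hs.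
  exists set0, 1; split => //; exact: compact0.
have [|D [e [cD DX e0 HD]]] := IH.
  by move=> i si; apply: Hs; rewrite inE si orbT.
have [/= [D1 [D1n cD1 D1X] <-] r0 ar] := Hs _ (mem_head _ _).
(* Half of the slack at [a] keeps the inequality strict after the triangle inequality. *)
exists (D `|` D1), (Num.min e ((r - rho D1 (a - x)) / 2)); split.
- exact: compactU.
- by move=> alpha [/DX|/D1X].
- by rewrite lt_min e0 divr_gt0// subr_gt0.
move=> y Hy i; rewrite inE => /predU1P[->/=|si]; last first.
  apply: HD si => alpha Da; apply: le_trans (Hy alpha (or_introl Da)) _.
  by rewrite ge_min lexx.
apply: (@le_lt_trans _ _ (rho D1 (a - x) + (r - rho D1 (a - x)) / 2)).
  2: by lra.
apply: rho_le => // alpha Da.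
rewrite -(subrKA a) addrC [X in `|X|]char_evalE.
rewrite (le_trans (ler_normD _ _))// lerD//.
  exact: rho_ge.
by apply: le_trans (Hy alpha (or_intror Da)) _; rewrite ge_min lexx orbT.
Qed.

End Characters.

Theorem theorem2p7 (R : realType) (A : comAlgType R) (M : set A)
    (X : set (character A)) :
  quadratic_module M -> X !=set0 ->
  @closure (seminorm_topology (rho_family X)) M
    = Psd (X `&` nonneg_characters M).
Proof.
move=> QM _; apply/seteqP; split => a.
  move=> cla alpha [Xa Na]; apply/ler_addgt0Pr => e e0.
  have cs : compact [set alpha] by exact: compact_set1.
  have s0 : [set alpha] !=set0 by exists alpha.
  have XD : rho_family X (rho [set alpha]).
    by exists [set alpha] => //; split => // _ ->.
  (* An element of [M] within [e] of [a] at [alpha] forces [a] above [- e] there. *)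
  have [|m [Mm /=]] := cla [set y | rho [set alpha] (y - a) < e].
    apply: nbhs_rho_ball => //; rewrite subrr.
    by rewrite (le_lt_trans _ e0)// rho_le// => beta _; rewrite char_evalE normr0.
  move=> /(le_lt_trans (rho_ge _ cs (erefl alpha))).
  by rewrite !char_evalE ltr_distl => /andP[_ H]; have := Na m Mm; lra.
move=> Pa B /nbhs_rho_family[D [e [cD DX e0 HB]]].
have [|m Mm Hm] := @Psd_approx R A M D a e QM cD _ e0.
  by move=> alpha [Da Na]; apply: Pa; split => //; exact: DX.
by exists m; split => //; exact: HB.
Qed.
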